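(* Let $V$ be a linear hyperplane of $\operatorname{M}_3(\mathbb{F}_2)$ which is not equivalent to $\mathcal{V}_1(\mathbb{F}_2)$, and let $f : V \to \operatorname{M}_3(\mathbb{F}_2)$ be an injective linear map such that for all $M \in V$, $f(M) \in \operatorname{GL}_3(\mathbb{F}_2)$ if and only if $M \in \operatorname{GL}_3(\mathbb{F}_2)$. Then $f$ extends to a Frobenius automorphism of $\operatorname{M}_3(\mathbb{F}_2)$.
   Context: $\mathcal{V}_1(\mathbb{F}_2)$ is the linear hyperplane of $\operatorname{M}_3(\mathbb{F}_2)$ consisting of all matrices whose $(3,3)$ entry is zero. Two linear subspaces $V,W$ of $\operatorname{M}_3(\mathbb{F}_2)$ are equivalent if $W=PVQ^{-1}$ for some $P,Q\in \operatorname{GL}_3(\mathbb{F}_2)$. A Frobenius automorphism of $\operatorname{M}_3(\mathbb{F}_2)$ is a map of the form $M\mapsto PMQ$ or of the form $M \mapsto PM^TQ$ for some $P,Q\in\operatorname{GL}_3(\mathbb{F}_2)$. *)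

(* Defs.v *)
(* MathComp (no analysis, no Stdlib reals). *)
From HB Require Import structures.
From mathcomp Require Import all_boot all_order all_algebra.

Set Implicit Arguments.
Unset Strict Implicit.
Unset Printing Implicit Defensive.

Import GRing.Theory.
Local Open Scope ring_scope.

Notation M3F2 := 'M['F_2]_3.

Definition hyperplane (V : {vspace M3F2}) : Prop :=
  (\dim V).+1 = \dim {:M3F2}.

(* Indices start at 0, so [ord_max : 'I_3] is the third one; the regular
   module [('F_2)^o] is what makes the codomain a vector space. *)
Definition entry33 (M : M3F2) : ('F_2)^o := M ord_max ord_max.

Fact entry33_is_linear : linear entry33.
Proof. by move=> a M N; rewrite /entry33 !mxE. Qed.

HB.instance Definition _ :=
  GRing.isLinear.Build 'F_2 M3F2 ('F_2)^o _ entry33 entry33_is_linear.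

Definition V1 : {vspace M3F2} := lker (linfun entry33).

Lemma mem_V1 (M : M3F2) : (M \in V1) = (M ord_max ord_max == 0).
Proof. by rewrite memv_ker lfunE. Qed.

Definition equivalent (V W : {vspace M3F2}) : Prop :=
  exists P Q : M3F2,
    [/\ P \in unitmx, Q \in unitmx
      & forall N : M3F2,
          N \in W <-> exists2 M, M \in V & N = P *m M *m invmx Q].

Definition frobenius_automorphism (g : M3F2 -> M3F2) : Prop :=
  exists P Q : M3F2,
    [/\ P \in unitmx, Q \in unitmx
      & (forall M, g M = P *m M *m Q) \/ (forall M, g M = P *m M^T *m Q)].

(* Main.v *)
Require Import Defs.
From mathcomp Require Import all_boot all_order all_algebra.

Set Implicit Arguments.
Unset Strict Implicit.
Unset Printing Implicit Defensive.

Import GRing.Theory.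
Local Open Scope ring_scope.

(** A linear hyperplane of M_3(F_2) is the kernel of M |-> tr(A M) for some
    nonzero A ([hyperplane_trace]).  Replacing A by L A U, with L and U
    invertible, replaces the hyperplane by an equivalent one, so only the rank
    of A matters.  Rank 1 gives V_1 ([equivalent_V1_of_rank1]), which is
    excluded; in ranks 2 and 3 the representatives [A2] and [A3] are chosen so
    that the hyperplane contains both the identity and the companion matrix C
    of X^3 + X + 1 ([C3] below).

    Let F be additive on M_3(F_2), preserving and reflecting invertibility on
    such a hyperplane.  The matrices F(1), F(C) and F(1) + F(C) = F(1 + C) are
    invertible, so Z = F(1)^-1 F(C) has neither 0 nor 1 as an eigenvalue: its
    characteristic polynomial is irreducible, hence X^3 + X + 1 or
    X^3 + X^2 + 1, and Z is conjugate to C or to C^-1 ([conj_C3_or_inv]).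
    Multiplying F by invertible matrices on both sides, one may assume that
    F(1) = 1 and that F(C) is C or C^-1.

    What remains is a finite verification, done by computation on matrices
    with boolean entries.  The vectors of a basis of the hyperplane are added
    one at a time to the span of 1 and C; each is given every possible image,
    and a choice is discarded as soon as the partial map does not preserve the
    determinant.  Few branches survive each step, and every map that reaches
    the end has the form M |-> P M P^-1 or M |-> P M^T P^-1.  [search_sound]
    relates the computation to F, and [certificate_A2] and [certificate_A3] run
    it. *)

(** * Matrices with boolean entries *)

Definition row3 : Type := (bool * bool * bool)%type.

(** The 3 x 3 matrices over F_2, as triples of rows; the boolean [true] is 1. *)
Definition mx3 : Type := (row3 * row3 * row3)%type.

Definition addr3 (u v : row3) : row3 :=
  let: (a, b, c) := u in let: (a', b', c') := v in
  (a (+) a', b (+) b', c (+) c').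

Definition add3 (s t : mx3) : mx3 :=
  let: (u, v, w) := s in let: (u', v', w') := t in
  (addr3 u u', addr3 v v', addr3 w w').

Definition tr3 (s : mx3) : mx3 :=
  let: ((a, b, c), (d, e, f), (g, h, i)) := s in
  ((a, d, g), (b, e, h), (c, f, i)).

Definition dot3 (u v : row3) : bool :=
  let: (a, b, c) := u in let: (a', b', c') := v in
  (a && a') (+) (b && b') (+) (c && c').

Definition mul3 (s t : mx3) : mx3 :=
  let: (u, v, w) := s in let: (x, y, z) := tr3 t in
  ((dot3 u x, dot3 u y, dot3 u z), (dot3 v x, dot3 v y, dot3 v z),
   (dot3 w x, dot3 w y, dot3 w z)).

Definition det3 (s : mx3) : bool :=
  let: ((a, b, c), (d, e, f), (g, h, i)) := s in
  (a && ((e && i) (+) (f && h))) (+) (b && ((d && i) (+) (f && g)))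
  (+) (c && ((d && h) (+) (e && g))).

Definition trace3 (s : mx3) : bool :=
  let: ((a, _, _), (_, e, _), (_, _, i)) := s in a (+) e (+) i.

Definition one3 : mx3 :=
  ((true, false, false), (false, true, false), (false, false, true)).

Definition all_row3 : seq row3 :=
  [seq (x.1, x.2, c) | x <- [seq (a, b) | a <- [:: true; false],
                                b <- [:: true; false]],
                       c <- [:: true; false]].
Definition all_mx3 : seq mx3 :=
  [seq (x.1, x.2, w) | x <- [seq (u, v) | u <- all_row3, v <- all_row3],
                       w <- all_row3].

Lemma mem_all_mx3 s : s \in all_mx3.
Proof.
have row u : u \in all_row3 by case: u => [[[] []] []].
case: s => [[u v] w]; apply/allpairsP; exists ((u, v), w); split=> //.
by apply/allpairsP; exists (u, v); rewrite !row.
Qed.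

Definition i0 : 'I_3 := Ordinal (isT : 0 < 3)%N.
Definition i1 : 'I_3 := Ordinal (isT : 1 < 3)%N.
Definition i2 : 'I_3 := Ordinal (isT : 2 < 3)%N.

(** The translation from matrices to boolean matrices, with inverse [mx_of]. *)
Definition bits (M : M3F2) : mx3 :=
  let r i := (M i i0 != 0, M i i1 != 0, M i i2 != 0) in (r i0, r i1, r i2).

Definition mx_of (s : mx3) : M3F2 :=
  let p (T : Type) (u : T * T * T) (i : 'I_3) :=
    let: (x, y, z) := u in if i == i0 then x else if i == i1 then y else z in
  \matrix_(i, j) (p _ (p _ s i) j)%:R.

(** Case analysis on the three elements of ['I_3]. *)
Lemma ord3P (P : 'I_3 -> Prop) : P i0 -> P i1 -> P i2 -> forall i, P i.
Proof.
move=> P0 P1 P2 [[|[|[|//]]] lt_i].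
- by rewrite (_ : Ordinal _ = i0) //; apply: val_inj.
- by rewrite (_ : Ordinal _ = i1) //; apply: val_inj.
- by rewrite (_ : Ordinal _ = i2) //; apply: val_inj.
Qed.

Lemma mx_ofK : cancel mx_of bits.
Proof.
have b01 (b : bool) : ((b%:R : 'F_2) != 0) = b by case: b.
by case=> [[[[a b] c] [[d e] f]] [[g h] i]]; rewrite /bits !mxE /= !b01.
Qed.

Lemma bitsK : cancel bits mx_of.
Proof.
have neq0K (x : 'F_2) : (x != 0)%:R = x.
  by case: x => [[|[|//]] ?]; apply: val_inj.
move=> M; apply/matrixP => i j; rewrite mxE.
by elim/ord3P: i; elim/ord3P: j; rewrite /= neq0K.
Qed.

Lemma bits_inj : injective bits. Proof. exact: can_inj bitsK. Qed.

Lemma F2_add_neq0 (x y : 'F_2) : (x + y != 0) = (x != 0) (+) (y != 0).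
Proof. by case: x y => [[|[|//]] ?] [[|[|//]] ?]. Qed.

Lemma F2_mul_neq0 (x y : 'F_2) : (x * y != 0) = (x != 0) && (y != 0).
Proof. by rewrite mulf_eq0 negb_or. Qed.

(** * Translation of the matrix operations *)

Lemma det_mx22 (R : comPzRingType) (M : 'M[R]_2) :
  \det M = M ord0 ord0 * M ord_max ord_max - M ord0 ord_max * M ord_max ord0.
Proof.
rewrite (expand_det_row M ord0) !big_ord_recl big_ord0 addr0 /cofactor.
rewrite !det_mx11 !mxE expr0 expr1 mul1r mulN1r mulrN.
by congr (M _ _ * M _ _ - M _ _ * M _ _); apply: val_inj.
Qed.

Lemma big_ord3 (R : nmodType) (F : 'I_3 -> R) : \sum_i F i = F i0 + F i1 + F i2.
Proof.
rewrite !big_ord_recl big_ord0 addr0 addrA.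
by congr (F _ + F _ + F _); apply: val_inj.
Qed.

Lemma det_mx33 (R : comPzRingType) (M : 'M[R]_3) :
  \det M = M i0 i0 * (M i1 i1 * M i2 i2 - M i1 i2 * M i2 i1)
         - M i0 i1 * (M i1 i0 * M i2 i2 - M i1 i2 * M i2 i0)
         + M i0 i2 * (M i1 i0 * M i2 i1 - M i1 i1 * M i2 i0).
Proof.
have l (i : 'I_3) (j : 'I_2) (k : 'I_3) : bump i j = k -> lift i j = k.
  by move=> ijk; apply: val_inj.
rewrite (expand_det_row M i0) big_ord3 /cofactor /= expr0 expr1 sqrrN expr1n.
rewrite !mul1r mulN1r mulrN !det_mx22 !mxE.
by rewrite (l i0 ord0 i1) // (l i0 ord_max i2) // (l i1 ord0 i0) //
  (l i1 ord_max i2) // (l i2 ord0 i0) // (l i2 ord_max i1).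
Qed.

Lemma bitsD M N : bits (M + N) = add3 (bits M) (bits N).
Proof. by rewrite /bits !mxE !F2_add_neq0. Qed.

Lemma bitsM M N : bits (M *m N) = mul3 (bits M) (bits N).
Proof. by rewrite /bits !mxE !big_ord3 !F2_add_neq0 !F2_mul_neq0. Qed.

Lemma bits_tr M : bits M^T = tr3 (bits M).
Proof. by rewrite /bits !mxE. Qed.

Lemma bits1 : bits 1%:M = one3.
Proof. by rewrite /bits !mxE. Qed.

Lemma bits_trace M : (\tr M != 0) = trace3 (bits M).
Proof. by rewrite /mxtrace big_ord3 !F2_add_neq0. Qed.

Lemma bits_unit (M : M3F2) : (M \in unitmx) = det3 (bits M).
Proof.
have oppF2 (x : 'F_2) : - x = x by case: x => [[|[|//]] ?]; apply: val_inj.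
by rewrite unitmxE unitfE det_mx33 !oppF2 !(F2_add_neq0, F2_mul_neq0).
Qed.

(** * The search *)

(** The same as [all], but under call-by-value reduction it stops at the first
    element that fails; the search relies on this to prune early. *)
Fixpoint every (T : Type) (p : pred T) (s : seq T) : bool :=
  if s is x :: s' then if p x then every p s' else false else true.

Lemma everyE (T : Type) (p : pred T) s : every p s = all p s.
Proof. by elim: s => //= x s ->; case: (p x). Qed.

(** Membership of [s] in the hyperplane of equation tr([a] [s]) = 0. *)
Definition in_hyperplane3 (a s : mx3) : bool := ~~ trace3 (mul3 a s).

(** The sums of an element of [S] and of a sub-sum of [bs]. *)
Fixpoint span3 (bs S : seq mx3) : seq mx3 :=
  if bs is b :: bs' then span3 bs' (S ++ [seq add3 v b | v <- S]) else S.

(** [G] is the graph, as a list of pairs, of an additive map on a subspace.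
    [search X bs G] tries every image [c] in [X] for the head [b] of [bs], keeps
    those for which the extension of the map to the span of its domain and [b]
    preserves the determinant, and goes on from there.  It succeeds if every
    map that survives until [bs] is exhausted is of the form v |-> P v P^-1 or
    v |-> P v^T P^-1, with P in [X] invertible. *)
Fixpoint search (X bs : seq mx3) (G : seq (mx3 * mx3)) : bool :=
  if bs is b :: bs' then
    all (fun c =>
      if every (fun vw => det3 (add3 vw.2 c) == det3 (add3 vw.1 b)) G
      then search X bs' (G ++ [seq (add3 vw.1 b, add3 vw.2 c) | vw <- G])
      else true) X
  else
    has (fun P => det3 P &&
      (every (fun vw => mul3 vw.2 P == mul3 P vw.1) G
       || every (fun vw => mul3 vw.2 P == mul3 P (tr3 vw.1)) G)) X.

Lemma in_hyperplane3E a M : in_hyperplane3 a (bits M) = (\tr (mx_of a *m M) == 0).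
Proof. by rewrite /in_hyperplane3 -{1}[a]mx_ofK -bitsM -bits_trace negbK. Qed.

Lemma in_hyperplane3D a s t :
  in_hyperplane3 a s -> in_hyperplane3 a t -> in_hyperplane3 a (add3 s t).
Proof.
rewrite -[s]mx_ofK -[t]mx_ofK -bitsD !in_hyperplane3E mulmxDr raddfD /=.
by move=> /eqP-> /eqP->; rewrite addr0.
Qed.

(** A successful search is exhaustive: any additive [F] that preserves the
    determinant follows one of its surviving branches, as [c] ranges over all
    matrices and hence takes the value [F b]. *)
Lemma search_sound a (F : mx3 -> mx3) (X bs : seq mx3) (G : seq (mx3 * mx3)) :
    (forall s, s \in X) ->
    {morph F : s t / add3 s t} ->
    (forall s, in_hyperplane3 a s -> det3 (F s) = det3 s) ->
    all (in_hyperplane3 a) bs ->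
    (forall v w, (v, w) \in G -> in_hyperplane3 a v /\ w = F v) ->
    search X bs G ->
  exists2 P, det3 P &
    (forall v, v \in span3 bs (unzip1 G) -> mul3 (F v) P = mul3 P v) \/
    (forall v, v \in span3 bs (unzip1 G) -> mul3 (F v) P = mul3 P (tr3 v)).
Proof.
move=> XT FD Fdet; elim: bs G => [|b bs IH] G /=.
  move=> _ FG /hasP[P _ /andP[detP]]; rewrite !everyE => PG; exists P => //.
  by case/orP: PG => /allP PG; [left | right] => v /mapP[[v' w] Gvw ->] /=;
    have [_ <-] := FG _ _ Gvw; apply/eqP/(PG _ Gvw).
case/andP=> ab abs FG.
have FGb v w : (v, w) \in G -> in_hyperplane3 a (add3 v b)
    /\ add3 w (F b) = F (add3 v b).
  by case/FG=> av ->; split; [apply: in_hyperplane3D | rewrite FD].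
(* Follow the branch in which the image of b is F b. *)
move/allP/(_ (F b) (XT _)); rewrite everyE ifT => [/IH|].
  rewrite /unzip1 map_cat -!map_comp; apply=> // v w.
  rewrite mem_cat => /orP[/FG // |].
  by case/mapP=> [[v' w'] /= Gvw [-> ->]]; apply: FGb.
by apply/allP=> -[v w] /= /FGb[av ->]; rewrite Fdet.
Qed.

Definition zero3 : mx3 :=
  ((false, false, false), (false, false, false), (false, false, false)).

(** The companion matrix of X^3 + X + 1, and its inverse. *)
Definition C3 : mx3 :=
  ((false, true, false), (false, false, true), (true, true, false)).

Definition C3inv : mx3 :=
  ((true, false, true), (true, false, false), (false, true, false)).

(** The graph of the additive map on the span of 1 and C that fixes 1 and sends
    C to [X]. *)
Definition start (X : mx3) : seq (mx3 * mx3) :=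
  [:: (zero3, zero3); (one3, one3); (C3, X); (add3 one3 C3, add3 one3 X)].

(** The computation for the hyperplane of [a]: it contains 1, C and [bs], it is
    spanned by them, and the search succeeds both when C is sent to C and when
    it is sent to C^-1. *)
Definition certificate (a : mx3) (bs : seq mx3) : bool :=
  [&& in_hyperplane3 a one3, in_hyperplane3 a C3, all (in_hyperplane3 a) bs,
      all (fun s => in_hyperplane3 a s ==> (s \in span3 bs (unzip1 (start C3))))
          all_mx3,
      search all_mx3 bs (start C3) & search all_mx3 bs (start C3inv)].

(** Representatives of ranks 2 and 3 for the matrix that defines the hyperplane;
    both satisfy tr(A) = tr(A C) = 0. *)
Definition A2 : mx3 :=
  ((true, false, false), (false, true, false), (false, false, false)).
Definition A3 : mx3 :=
  ((true, false, false), (false, true, true), (false, true, false)).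

(** Vectors completing 1, C to a basis of the hyperplane of [A2], respectively
    [A3].  Any completion would do; with these the search has at most 56 partial
    maps at any stage. *)
Definition basis2 : seq mx3 := [::
  ((false, false, false), (true, false, false), (false, true, false));
  ((false, false, true), (false, false, false), (false, false, false));
  ((false, false, false), (false, false, false), (false, true, false));
  ((false, false, false), (false, false, false), (true, false, false));
  ((false, false, true), (false, false, true), (false, false, false));
  ((true, false, false), (false, true, false), (false, false, false))].

Definition basis3 : seq mx3 := [::
  ((true, false, true), (true, false, false), (false, true, false));
  ((false, false, false), (false, true, false), (false, true, false));
  ((false, true, false), (false, false, false), (false, false, false));
  ((false, false, false), (false, false, false), (true, false, false));
  ((false, false, false), (true, false, false), (false, false, true));
  ((false, false, false), (false, false, false), (false, false, true))].

Lemma certificate_A2 : certificate A2 basis2.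
Proof. by vm_compute. Qed.

Lemma certificate_A3 : certificate A3 basis3.
Proof. by vm_compute. Qed.

(** A matrix without eigenvalue in F_2 is conjugate to C or to C^-1, verified
    over the 512 matrices. *)
Lemma conj_C3_or_inv Z : det3 Z -> det3 (add3 one3 Z) ->
  exists2 P, det3 P & mul3 P Z = mul3 C3 P \/ mul3 P Z = mul3 C3inv P.
Proof.
have chk : every (fun Z => if det3 Z && det3 (add3 one3 Z) then
    has (fun P => det3 P && ((mul3 P Z == mul3 C3 P)
                              || (mul3 P Z == mul3 C3inv P))) all_mx3
    else true) all_mx3 by vm_compute.
rewrite everyE in chk; move/allP/(_ Z (mem_all_mx3 Z)): chk.
move=> chk dZ d1Z; rewrite dZ d1Z in chk; case/hasP: chk => P _ /andP[dP PZ].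
by exists P => //; case/orP: PZ => /eqP; [left | right].
Qed.

(** * From the computation to matrices *)

(** [F] agrees with a Frobenius automorphism on the hyperplane tr([A] M) = 0. *)
Definition frobenius_on (A : M3F2) (F : M3F2 -> M3F2) : Prop :=
  exists2 g, frobenius_automorphism g & forall M, \tr (A *m M) = 0 -> F M = g M.

Lemma frobenius_mul P Q R S g : P \in unitmx -> Q \in unitmx ->
    R \in unitmx -> S \in unitmx -> frobenius_automorphism g ->
  frobenius_automorphism (fun M => P *m g (R *m M *m S) *m Q).
Proof.
move=> uP uQ uR uS [P' [Q' [uP' uQ' [gE | gE]]]].
  exists (P *m P' *m R), (S *m Q' *m Q).
  split; rewrite ?unitmx_mul ?uP ?uP' ?uR ?uS ?uQ ?uQ' //.
  by left=> M; rewrite gE !mulmxA.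
exists (P *m P' *m S^T), (R^T *m Q' *m Q).
split; rewrite ?unitmx_mul ?unitmx_tr ?uP ?uP' ?uR ?uS ?uQ ?uQ' //.
by right=> M; rewrite gE !trmx_mul !mulmxA.
Qed.

(** [F] preserves and reflects invertibility on the hyperplane tr([A] M) = 0. *)
Definition preserves_unit_on (A : M3F2) (F : M3F2 -> M3F2) : Prop :=
  forall M, \tr (A *m M) = 0 -> (F M \in unitmx) = (M \in unitmx).

Lemma certificate_normalized a bs (F : M3F2 -> M3F2) : certificate a bs ->
    {morph F : M N / M + N} -> preserves_unit_on (mx_of a) F ->
    F 1%:M = 1%:M ->
    F (mx_of C3) = mx_of C3 \/ F (mx_of C3) = mx_of C3inv ->
  frobenius_on (mx_of a) F.
Proof.
case/and5P=> a1 aC abs /allP cover /andP[sC sCi] FD FU F1 FC.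
pose F' s := bits (F (mx_of s)).
have add_of s t : mx_of (add3 s t) = mx_of s + mx_of t.
  by apply: bits_inj; rewrite bitsD !mx_ofK.
have one_of : mx_of one3 = 1%:M by apply: bits_inj; rewrite mx_ofK bits1.
have F'D : {morph F' : s t / add3 s t} by move=> s t; rewrite /F' add_of FD bitsD.
have F'det s : in_hyperplane3 a s -> det3 (F' s) = det3 s.
  move=> as_; rewrite -[in RHS](mx_ofK s) -!bits_unit; apply: FU.
  by apply/eqP; rewrite -in_hyperplane3E mx_ofK.
have F'1 : F' one3 = one3 by rewrite /F' one_of F1 bits1.
have F'0 : F' zero3 = zero3.
  by have := F'D one3 one3; rewrite F'1.
have [P dP HP] : exists2 P, det3 P &
    (forall v, in_hyperplane3 a v -> mul3 (F' v) P = mul3 P v) \/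
    (forall v, in_hyperplane3 a v -> mul3 (F' v) P = mul3 P (tr3 v)).
  have sX X : F' C3 = X -> search all_mx3 bs (start X) -> exists2 P, det3 P &
    (forall v, in_hyperplane3 a v -> mul3 (F' v) P = mul3 P v) \/
    (forall v, in_hyperplane3 a v -> mul3 (F' v) P = mul3 P (tr3 v)).
    move=> F'C sX.
    have [|P dP HP] := search_sound mem_all_mx3 F'D F'det abs _ sX.
      have pair_inj (x y x' y' : mx3) : (x, y) == (x', y') -> x = x' /\ y = y'.
        by move/eqP=> [-> ->].
      move=> v w; rewrite !inE => /or4P[] /pair_inj[-> ->].
      - by rewrite F'0; split=> //; case: (a) => [[[[? ?] ?] [[? ?] ?]] [[? ?] ?]];
          rewrite /in_hyperplane3 /= !andbF.
      - by rewrite F'1.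
      - by rewrite F'C.
      - by rewrite F'D F'1 F'C; split=> //; apply: in_hyperplane3D.
    exists P => //; case: HP => HP; [left | right] => v av; apply: HP;
      exact: (implyP (cover v (mem_all_mx3 v))).
  by case: FC => FC; [apply: sX sC | apply: sX sCi]; rewrite /F' FC mx_ofK.
have uP : mx_of P \in unitmx by rewrite bits_unit mx_ofK.
have conj M N : mul3 (F' (bits M)) P = mul3 P (bits N) ->
    F M = mx_of P *m N *m invmx (mx_of P).
  move=> E; rewrite -(mulmxK uP (F M)); congr (_ *m _).
  by apply: bits_inj; rewrite !bitsM mx_ofK -E /F' bitsK.
case: HP => HP.
  exists (fun M => mx_of P *m M *m invmx (mx_of P)) => [|M /eqP aM].
    by exists (mx_of P), (invmx (mx_of P)); rewrite unitmx_inv uP; split=> //; left.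
  by apply: conj; apply: HP; rewrite in_hyperplane3E.
exists (fun M => mx_of P *m M^T *m invmx (mx_of P)) => [|M /eqP aM].
  by exists (mx_of P), (invmx (mx_of P)); rewrite unitmx_inv uP; split=> //; right.
by apply: conj; rewrite bits_tr; apply: HP; rewrite in_hyperplane3E.
Qed.

(** Normalization of F(1) and F(C): with X = F(1), Y = F(C) and R conjugating
    X^-1 Y to C or C^-1, the map M |-> R X^-1 F(M) R^-1 fixes 1 and sends C to C
    or C^-1. *)
Lemma certificate_frobenius a bs (F : M3F2 -> M3F2) : certificate a bs ->
    {morph F : M N / M + N} -> preserves_unit_on (mx_of a) F ->
  frobenius_on (mx_of a) F.
Proof.
move=> cert FD FU; have /and5P[a1 aC _ _ _] := cert.
have one_of : mx_of one3 = 1%:M by apply: bits_inj; rewrite mx_ofK bits1.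
have FU' s : in_hyperplane3 a s -> (F (mx_of s) \in unitmx) = det3 s.
  move=> as_; rewrite FU ?bits_unit ?mx_ofK //.
  by apply/eqP; rewrite -in_hyperplane3E mx_ofK.
have uX : F 1%:M \in unitmx by rewrite -one_of FU'.
have uY : F (mx_of C3) \in unitmx by rewrite FU'.
have uXY : F 1%:M + F (mx_of C3) \in unitmx.
  rewrite -FD (_ : _ + _ = mx_of (add3 one3 C3)) ?FU' ?in_hyperplane3D //.
  by apply: bits_inj; rewrite bitsD bits1 !mx_ofK.
have [X XE] : {X | X = F 1%:M} by exists (F 1%:M).
have [Y YE] : {Y | Y = F (mx_of C3)} by exists (F (mx_of C3)).
rewrite -XE in uX uXY; rewrite -YE in uY uXY.
have uX' : invmx X \in unitmx by rewrite unitmx_inv uX.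
have [|| R dR HR] := @conj_C3_or_inv (bits (invmx X *m Y)).
- by rewrite -bits_unit unitmx_mul uX'.
- by rewrite -bits1 -bitsD -bits_unit -(mulVmx uX) -mulmxDr unitmx_mul uX'.
have [R' RE] : {R' | bits R' = R} by exists (mx_of R); exact: mx_ofK.
have uR : R' \in unitmx by rewrite bits_unit RE.
have uR' : invmx R' \in unitmx by rewrite unitmx_inv uR.
have conj c : mul3 R (bits (invmx X *m Y)) = mul3 c R ->
    R' *m (invmx X *m Y) *m invmx R' = mx_of c.
  move=> E; rewrite -(mulmxK uR (mx_of c)); congr (_ *m _).
  by apply: bits_inj; rewrite bitsM RE E bitsM mx_ofK RE.
have [||||g gF gE] := @certificate_normalized a bs
    (fun M => R' *m (invmx X *m F M) *m invmx R') cert.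
- by move=> M N; rewrite FD !(mulmxDr, mulmxDl).
- by move=> M aM; rewrite !unitmx_mul uR uR' uX' FU ?andbT.
- by rewrite -XE (mulVmx uX) mulmx1 (mulmxV uR).
- by rewrite -YE; case: HR => /conj; [left | right].
exists (fun M => X *m invmx R' *m g (1%:M *m M *m 1%:M) *m R') => [|M aM].
  by apply: frobenius_mul; rewrite ?unitmx_mul ?unitmx1 ?uX.
by rewrite mul1mx mulmx1 -gE // !mulmxA !(mulmxKV uR) (mulmxV uX) mul1mx.
Qed.

(** * Hyperplanes up to equivalence *)

Lemma equiv_of_rank (F : fieldType) m n (A B : 'M[F]_(m, n)) :
  \rank A = \rank B ->
  exists L U, [/\ L \in unitmx, U \in unitmx & A = L *m B *m U].
Proof.
move=> rAB; exists (col_ebase A *m invmx (col_ebase B)).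
exists (invmx (row_ebase B) *m row_ebase A).
rewrite !unitmx_mul !unitmx_inv !col_ebase_unit !row_ebase_unit; split=> //.
rewrite -{2}(mulmx_ebase B) -{1}(mulmx_ebase A) rAB !mulmxA.
by rewrite (mulmxKV (col_ebase_unit B)) (mulmxK (row_ebase_unit B)).
Qed.

Lemma mxtrace_equiv (R : comNzRingType) n (L B U M : 'M[R]_n) :
  \tr (L *m B *m U *m M) = \tr (B *m (U *m M *m L)).
Proof. by rewrite -!mulmxA mxtrace_mulC !mulmxA. Qed.

(** The statement for [B] implies it for [L *m B *m U], since
    tr(L B U M) = tr(B (U M L)). *)
Lemma frobenius_on_equiv L B U F : L \in unitmx -> U \in unitmx ->
    {morph F : M N / M + N} -> preserves_unit_on (L *m B *m U) F ->
    (forall G, {morph G : M N / M + N} -> preserves_unit_on B G ->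
      frobenius_on B G) ->
  frobenius_on (L *m B *m U) F.
Proof.
move=> uL uU FD FU HB.
have [||g gF gE] := HB (fun N => F (invmx U *m N *m invmx L)).
- by move=> M N; rewrite mulmxDr mulmxDl FD.
- move=> N BN; rewrite FU ?mxtrace_equiv ?unitmx_mul ?unitmx_inv ?uL ?uU ?andbT //.
  by rewrite !mulmxA (mulmxK uU) (mulmxKV uL).
exists (fun M => 1%:M *m g (U *m M *m L) *m 1%:M) => [|M].
  by apply: frobenius_mul; rewrite ?unitmx1.
rewrite mxtrace_equiv mul1mx mulmx1 => /gE <-.
by rewrite !mulmxA mulVmx // mul1mx mulmxK.
Qed.

Lemma hyperplane_trace (V : {vspace M3F2}) : hyperplane V ->
  exists A : M3F2, forall M, (M \in V) = (\tr (A *m M) == 0).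
Proof.
rewrite /hyperplane => hV.
(* A complement of V is a line spanned by w, and psi is the projection onto it
   along V.  A nonzero entry (i, j) of w makes M |-> psi M i j a linear form
   with kernel V; A collects its values on the elementary matrices. *)
have dimC : \dim V^C = 1%N by rewrite dimv_compl -hV subSnn.
pose w := vpick V^C; pose psi : 'End(M3F2) := (\1 - projv V)%VF.
have psiB M : psi M = M - projv V M by rewrite !lfun_simp.
have w_neq0 : w != 0 by rewrite vpick0 -dimv_eq0 dimC.
have psi_line M : exists a, psi M = a *: w.
  have VC : (V^C = <[w]>)%VS.
    by apply/esym/eqP; rewrite eqEdim -memvE memv_pick dimC dim_vline w_neq0.
  by apply/vlineP; rewrite -VC psiB memv_projC.
have psiE M : (M \in V) = (psi M == 0).
  apply/idP/eqP => [VM | /eqP]; first by rewrite psiB projv_id ?subrr.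
  by rewrite psiB subr_eq0 => /eqP->; apply: memv_proj.
have [[i j] /= wij] : exists ij, w ij.1 ij.2 != 0.
  apply/existsP; apply: contra_neqT w_neq0; rewrite negb_exists => /forallP w0.
  by apply/matrixP => i j; rewrite mxE; apply/eqP; have := w0 (i, j); rewrite negbK.
exists (\matrix_(k, l) psi (delta_mx l k) i j) => M.
rewrite psiE; have -> : (psi M == 0) = (psi M i j == 0).
  have [a ->] := psi_line M; rewrite mxE mulf_eq0 (negPf wij) orbF.
  by rewrite scaler_eq0 (negPf w_neq0) orbF.
congr (_ == _); rewrite {1}(matrix_sum_delta M) mxtrace_mulC /mxtrace.
rewrite linear_sum summxE; apply: eq_bigr => k _.
rewrite mxE linear_sum summxE; apply: eq_bigr => l _.
by rewrite linearZ !mxE.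
Qed.

Lemma mx_of_A2 : mx_of A2 = pid_mx 2.
Proof.
by apply: bits_inj; rewrite mx_ofK /bits !mxE.
Qed.

Lemma rank_A3 : \rank (mx_of A3) = 3.
Proof. by apply: mxrank_unit; rewrite bits_unit mx_ofK. Qed.

Lemma equivalent_V1_of_rank1 (V : {vspace M3F2}) (A : M3F2) :
  (forall M, (M \in V) = (\tr (A *m M) == 0)) -> \rank A = 1%N -> equivalent V V1.
Proof.
move=> VE rA.
have [|L [U [uL uU AE]]] := @equiv_of_rank _ _ _ A (delta_mx ord_max ord_max).
  by rewrite mxrank_delta.
have trE N : \tr (delta_mx ord_max ord_max *m N) = N ord_max ord_max.
  rewrite /mxtrace (bigD1 ord_max) //= big1 ?addr0 => [|i ni]; rewrite !mxE.
    rewrite (bigD1 ord_max) //= big1 ?addr0 ?mxE ?eqxx ?mul1r // => j nj.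
    by rewrite mxE (negPf nj) andbF mul0r.
  by rewrite big1 // => j _; rewrite mxE (negPf ni) mul0r.
exists U, (invmx L); rewrite unitmx_inv; split=> // N; rewrite mem_V1 invmxK.
split=> [N0 | [M VM ->]].
  exists (invmx U *m N *m invmx L).
    by rewrite VE AE mxtrace_equiv trE !mulmxA mulmxV // mul1mx mulmxKV.
  by rewrite !mulmxA mulmxV // mul1mx mulmxKV.
by rewrite -trE -mxtrace_equiv -AE -VE.
Qed.

Theorem theorem22 (V : {vspace M3F2}) (f : {linear subvs_of V -> M3F2})
    (hV : hyperplane V) (hV1 : ~ equivalent V V1) (finj : injective f)
    (fGL : forall M : subvs_of V, f M \in unitmx <-> vsval M \in unitmx) :
  exists g : M3F2 -> M3F2,
    frobenius_automorphism g /\ forall M : subvs_of V, f M = g (vsval M).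
Proof.
have [A VE] := hyperplane_trace hV.
(* f is extended to all matrices through a projection onto V. *)
pose F M := f (vsproj V M).
have FD : {morph F : M N / M + N} by move=> M N; rewrite /F !linearD.
have FU : preserves_unit_on A F.
  move=> M /eqP; rewrite -VE => VM; apply/idP/idP; rewrite /F.
    by move/fGL; rewrite vsprojK.
  by move=> uM; apply/fGL; rewrite vsprojK.
have [g gF gE] : frobenius_on A F.
  have [] : [\/ \rank A = 0%N, \rank A = 1%N | \rank A = \rank (mx_of A2)]
    \/ \rank A = \rank (mx_of A3).
    rewrite mx_of_A2 rank_A3 rank_pid_mx //.
    by case: (\rank A) (rank_leq_row A) => [|[|[|[|]]]] // _;
      [left; constructor 1 | left; constructor 2 | left; constructor 3 | right].
  - case=> [/eqP | /(equivalent_V1_of_rank1 VE) // | /equiv_of_rank].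
      rewrite mxrank_eq0 => /eqP A0; exfalso; move: hV.
      rewrite /hyperplane (_ : V = fullv); first by move/eqP; rewrite eqn_leq ltnn.
      by apply/vspaceP => M; rewrite VE A0 mul0mx mxtrace0 eqxx memvf.
    case=> L [U [uL uU AE]]; rewrite AE in FU *; apply: frobenius_on_equiv => //.
    by move=> G; apply: certificate_frobenius certificate_A2.
  case/equiv_of_rank=> L [U [uL uU AE]]; rewrite AE in FU *.
  apply: frobenius_on_equiv => // G; exact: certificate_frobenius certificate_A3.
exists g; split=> // M; rewrite -gE /F ?vsvalK //.
by apply/eqP; rewrite -VE subvsP.
Qed.
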